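(* A matrix $\bar X\in\mathbb{R}^{m\times n}$ is a global minimizer of $\min_{X\in\mathbb{R}^{m\times n}}\mathcal F_{\ell_0}(X):=f(X)+\lambda\|\sigma(X)\|_0$ if and only if it is a global minimizer of $\min_{X\in\mathbb{R}^{m\times n}}\mathcal F(X):=f(X)+\lambda\Phi(X)$. Moreover, the two problems have the same optimal value.
   Context: Let $n\le m$ be positive integers. For $X\in\mathbb{R}^{m\times n}$, $\sigma(X)=(\sigma_1(X),\dots,\sigma_n(X))^T$ is the vector of singular values with $\sigma_1(X)\ge\dots\ge\sigma_n(X)\ge0$, and $\|\sigma(X)\|_0$ is its number of nonzero entries, i.e. $\operatorname{rank}(X)$. Standing assumptions: $\lambda>0$; $f:\mathbb{R}^{m\times n}\to[0,\infty)$ is convex (not necessarily smooth) and Lipschitz continuous with constant $L_f>0$ with respect to the Frobenius norm; the parameter $\nu$ satisfies $0<\nu<\bar\nu:=\lambda/L_f$. $\Phi(X)=\sum_{i=1}^n\phi(\sigma_i(X))$, where $\phi(t)=\min\{1,t/\nu\}$ for $t\ge0$. *)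

(* Defs.v *)
From mathcomp Require Import all_boot all_order all_algebra.
From mathcomp Require Import complex.
From mathcomp Require Import all_classical all_reals all_analysis.

Set Implicit Arguments.
Unset Strict Implicit.
Unset Printing Implicit Defensive.
Import Order.TTheory GRing.Theory Num.Theory.
Local Open Scope classical_set_scope.
Local Open Scope ring_scope.

(* The library's norm on matrices is the sup norm, hence this definition. *)
Definition frobenius_norm (R : rcfType) (m n : nat) (X : 'M[R]_(m, n)) : R :=
  Num.sqrt (\sum_(i < m) \sum_(j < n) X i j ^+ 2).

(* The eigenvalues of X^T X, with multiplicity, are read off the library's
   unitary diagonalization, which is over R[i]; their real parts are taken only
   to return to R.  See [char_poly_gram_singular_values] below.  *)
Definition singular_values (R : rcfType) (m n : nat) (X : 'M[R]_(m, n)) :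
    n.-tuple R :=
  let D := spectral_diag (map_mx (real_complex R) (X^T *m X)) in
  sort_tuple >=%R [tuple Num.sqrt (complex.Re (D 0 i)) | i < n].

Definition norm0 (R : rcfType) (n : nat) (s : n.-tuple R) : nat :=
  #|[set i : 'I_n | tnth s i != 0]%SET|.

(* The capped-l1 function; it is only meant for t >= 0. *)
Definition capped (R : rcfType) (nu t : R) : R := Num.min 1 (t / nu).

Definition Phi (R : rcfType) (m n : nat) (nu : R) (X : 'M[R]_(m, n)) : R :=
  \sum_(i < n) capped nu (tnth (singular_values X) i).

Definition F_l0 (R : rcfType) (m n : nat) (f : 'M[R]_(m, n) -> R) (lambda : R)
    (X : 'M[R]_(m, n)) : R :=
  f X + lambda * (norm0 (singular_values X))%:R.

Definition F_relaxed (R : rcfType) (m n : nat) (f : 'M[R]_(m, n) -> R)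
    (lambda nu : R) (X : 'M[R]_(m, n)) : R :=
  f X + lambda * Phi nu X.

Definition global_minimizer (R : realType) (T : Type) (F : T -> R) (x : T) :
    Prop :=
  forall y, F x <= F y.

Definition optimal_value (R : realType) (T : Type) (F : T -> R) : \bar R :=
  ereal_inf (range (fun x => (F x)%:E)).

Lemma singular_values_sorted (R : rcfType) (m n : nat) (X : 'M[R]_(m, n)) :
  sorted >=%R (singular_values X).
Proof. by apply: sort_sorted => x y; exact: le_total. Qed.

Lemma singular_values_ge0 (R : rcfType) (m n : nat) (X : 'M[R]_(m, n)) i :
  0 <= tnth (singular_values X) i.
Proof.
have /= := mem_tnth i (singular_values X).
by rewrite mem_sort => /mapP[j _ ->]; exact: sqrtr_ge0.
Qed.

Section gram.
Variables (R : rcfType) (m n : nat) (X : 'M[R]_(m, n)).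
Let toC := real_complex R.
Let G := map_mx toC (X^T *m X).
Let P := spectralmx G.
Let D := spectral_diag G.

Let conj_real x : Num.conj (toC x) = toC x.
Proof. by apply/CrealP; rewrite complex_real. Qed.

Let conj_map p q (A : 'M[R]_(p, q)) :
  map_mx Num.conj (map_mx toC A) = map_mx toC A.
Proof. by apply/matrixP => i j; rewrite !mxE conj_real. Qed.

Let G_herm : G \is hermsymmx.
Proof.
apply/is_hermitianmxP; rewrite expr0 scale1r.
by rewrite /G map_trmx conj_map trmx_mul trmxK.
Qed.

Let G_spec : G = invmx P *m diag_mx D *m P.
Proof. exact/orthomx_spectralP/hermitian_normalmx/G_herm. Qed.

Let D_ge0 i : 0 <= D 0 i.
Proof.
have U : P \is unitarymx by exact: spectral_unitarymx.
pose Y := map_mx toC X *m invmx P.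
have YY : (map_mx Num.conj Y)^T *m Y = diag_mx D.
  have GE : map_mx toC X^T *m map_mx toC X = G by rewrite -map_mxM.
  rewrite /Y map_mxM conj_map trmx_mul.
  rewrite {1}invmx_unitary// -map_mx_comp.
  have -> : map_mx (Num.conj \o Num.conj) P^T = P^T.
    by apply/matrixP => i' j; rewrite !mxE/= conjCK.
  rewrite trmxK -mulmxA (mulmxA _^T) map_trmx GE G_spec.
  by rewrite !mulmxA mulmxV ?mul1mx ?spectral_unit// -mulmxA mulmxV
    ?spectral_unit// mulmx1.
have /matrixP/(_ i i) := YY; rewrite !mxE eqxx mulr1n => <-.
by apply: sumr_ge0 => k _; rewrite !mxE mulrC mul_conjC_ge0.
Qed.

Lemma char_poly_gram_singular_values :
  char_poly (X^T *m X) =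
  \prod_(i < n) ('X - (tnth (singular_values X) i ^+ 2)%:P).
Proof.
pose F (x : R) : {poly R} := 'X - (x ^+ 2)%:P.
rewrite -(big_tuple _ _ (singular_values X) xpredT F) /=.
rewrite (perm_big _ (permEl (perm_sort _ _))) /= big_map big_enum /=.
apply: (@map_poly_inj _ _ toC).
rewrite map_char_poly rmorph_prod /= -/G.
have simG : P *m G = diag_mx D *m P.
  by rewrite {1}G_spec !mulmxA mulmxV ?mul1mx ?spectral_unit.
have -> : char_poly G = char_poly (diag_mx D).
  have Pu := spectral_unit G; rewrite -/P in Pu.
  have E : map_mx polyC P *m char_poly_mx G
         = char_poly_mx (diag_mx D) *m map_mx polyC P.
    by rewrite /char_poly_mx mulmxBr mulmxBl -!map_mxM simG scalar_mxC.
  have dP : \det (map_mx polyC P) != 0.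
    by rewrite det_map_mx polyC_eq0 -unitfE -unitmxE.
  apply: (mulfI dP); rewrite /char_poly -det_mulmx E det_mulmx.
  by rewrite mulrC.
rewrite char_poly_trig ?diag_mx_is_trig//.
apply: eq_bigr => i _.
rewrite /F rmorphB /= map_polyX map_polyC /= mxE eqxx mulr1n.
congr ('X - _%:P).
have : 0 <= D 0 i by [].
rewrite -/D -/G; case: (D 0 i) => a b; rewrite lecE /= => /andP[/eqP-> a0].
by rewrite sqr_sqrtr.
Qed.

End gram.

(* Main.v *)
Require Import Defs.
From mathcomp Require Import all_boot all_order all_algebra complex.
From mathcomp Require Import all_classical all_reals all_analysis.
From mathcomp Require Import ring.

(** The relaxed objective never exceeds the l0 objective, because the capped
    function is at most the indicator of [t != 0] ([Phi_le_norm0]).  So it is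
    enough to send each [X] to some [Y] whose l0 value is at most the relaxed
    value of [X].  Such a [Y] is the hard thresholding of [X]: keep the singular
    values that are at least [nu] and replace the others by 0.  Let [S] be the
    sum of the singular values below [nu].  Then [Phi nu X] is the rank of [Y]
    plus [S / nu], while the Lipschitz bound gives [f Y <= f X + Lf * S], since
    the Frobenius distance from [X] to [Y] is the l2 norm of the removed values,
    hence at most [S].  The l0 value of [Y] is thus at most the relaxed value of
    [X] minus [(lambda / nu - Lf) * S], whose slope is positive
    ([threshold_decreases]).  The two infima therefore agree.  If moreover [X]
    minimizes the relaxed objective, then [S = 0]: no singular value lies
    strictly between 0 and [nu], and the two objectives agree at [X].

    The thresholded matrix is obtained without a singular value decomposition
    over the reals.  Take [Y = X p(X^T X)], where [p] is a real polynomial equal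
    to 1 or 0 at each eigenvalue of [X^T X] according to whether the singular
    value is kept or removed.  Both [Y^T Y] and [(X - Y)^T (X - Y)] are then
    polynomials in [X^T X], and [char_poly_horner_symmetric] gives their
    eigenvalues ([hard_threshold]). *)

Set Implicit Arguments.
Unset Strict Implicit.
Unset Printing Implicit Defensive.
Import Order.TTheory GRing.Theory Num.Theory.
Local Open Scope classical_set_scope.
Local Open Scope ring_scope.

(** * Polynomials of symmetric matrices *)

Lemma exists_interpolation (F : fieldType) (s : seq F) (g : F -> F) :
  exists p : {poly F}, {in s, forall x, p.[x] = g x}.
Proof.
elim: s => [|a s [p ps]]; first by exists 0.
have [a_s|a_s] := boolP (a \in s).
  by exists p => x; rewrite inE => /predU1P[->|]; apply: ps.
(* Newton's correction: w vanishes at the earlier nodes but not at a. *)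
pose w : {poly F} := \prod_(b <- s) ('X - b%:P).
have wa : w.[a] != 0 by rewrite -/(root w a) root_prod_XsubC.
exists (p + ((g a - p.[a]) / w.[a]) *: w) => x; rewrite inE !hornerE.
move=> /predU1P[->|xs]; first by rewrite divfK// addrC subrK.
by have /rootP -> : root w x; rewrite ?root_prod_XsubC// mulr0 addr0 ps.
Qed.

Lemma char_poly_horner_conj_diag (F : fieldType) n (P : 'M[F]_n.+1) d p :
  P \in unitmx ->
  char_poly (horner_mx (invmx P *m diag_mx d *m P) p) =
  \prod_(a <- [seq d 0 i | i : 'I_n.+1]) ('X - p.[a]%:P).
Proof.
move=> Pu; rewrite horner_mx_uconjC// horner_mx_diag.
set D := diag_mx _; rewrite big_map big_enum /=.
have -> : char_poly (invmx P *m D *m P) = char_poly D.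
  have E : map_mx polyC P *m char_poly_mx (invmx P *m D *m P)
         = char_poly_mx D *m map_mx polyC P.
    by rewrite /char_poly_mx mulmxBr mulmxBl -!map_mxM !mulmxA mulmxV// mul1mx
      scalar_mxC.
  (* Similar matrices: cancel the determinant of P, a nonzero constant. *)
  have dP : \det (map_mx polyC P) != 0.
    by rewrite det_map_mx polyC_eq0 -unitfE -unitmxE.
  by apply: (mulfI dP); rewrite /char_poly -det_mulmx E det_mulmx mulrC.
rewrite char_poly_trig ?diag_mx_is_trig//.
by apply: eq_bigr => i _; rewrite !mxE eqxx mulr1n.
Qed.

(** The spectral mapping theorem with multiplicities.  The spectral theorem is
    applied over [R[i]]; because [p] and the eigenvalues in [s] are real, the
    resulting factorization descends to [R]. *)
Lemma char_poly_horner_symmetric (R : rcfType) n (A : 'M[R]_n.+1) (s : seq R)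
    (p : {poly R}) :
  A^T = A -> char_poly A = \prod_(a <- s) ('X - a%:P) ->
  char_poly (horner_mx A p) = \prod_(a <- s) ('X - p.[a]%:P).
Proof.
move=> A_sym A_s; pose toC := real_complex R.
have conj_toC x : Num.conj (toC x) = toC x.
  by apply/CrealP; rewrite complex_real.
have herm : map_mx toC A \is hermsymmx.
  apply/is_hermitianmxP; rewrite expr0 scale1r map_trmx A_sym.
  by apply/matrixP => i j; rewrite !mxE conj_toC.
have /orthomx_spectralP := hermitian_normalmx herm.
set P := spectralmx _; set d := spectral_diag _ => A_diag.
have Pu : P \in unitmx by exact: spectral_unit.
have /prod_XsubC_eq d_s : \prod_(a <- [seq d 0 i | i : 'I_n.+1]) ('X - a%:P) =
    \prod_(a <- map toC s) ('X - a%:P).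
  transitivity (char_poly (map_mx toC A)).
    rewrite -[map_mx toC A]horner_mx_X A_diag char_poly_horner_conj_diag//.
    by apply: eq_bigr => a _; rewrite hornerX.
  rewrite -map_char_poly A_s rmorph_prod big_map /=.
  by apply: eq_bigr => a _; rewrite rmorphB /= map_polyX map_polyC.
apply: (@map_poly_inj _ _ toC).
rewrite map_char_poly map_horner_mx A_diag char_poly_horner_conj_diag//.
rewrite (perm_big _ d_s) big_map rmorph_prod /=.
by apply: eq_bigr => a _; rewrite rmorphB /= map_polyX map_polyC horner_map.
Qed.

Lemma mxtrace_char_poly (F : fieldType) n (A : 'M[F]_n.+1) (s : seq F) :
  char_poly A = \prod_(a <- s) ('X - a%:P) -> \tr A = \sum_(a <- s) a.
Proof.
move=> A_s; have sz : size s = n.+1.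
  by have := size_prod_XsubC s id; rewrite -A_s size_char_poly => -[].
apply: oppr_inj; by rewrite -char_poly_trace// A_s -coefPn_prod_XsubC sz.
Qed.

Lemma trmx_horner_mx (F : comNzRingType) n (A : 'M[F]_n.+1) (p : {poly F}) :
  (horner_mx A p)^T = horner_mx A^T p.
Proof.
elim/poly_ind: p => [|p c IH]; first by rewrite !rmorph0 trmx0.
rewrite !rmorphD !rmorphM /= !horner_mx_X !horner_mx_C linearD /= tr_scalar_mx.
congr (_ + _); rewrite -[_ * A]/(_ *m A) trmx_mul IH.
exact: (comm_mx_horner p (comm_mx_refl A^T)).
Qed.

(** * Hard thresholding of singular values *)

Lemma frobenius_norm_trace (R : rcfType) m n (X : 'M[R]_(m, n)) :
  frobenius_norm X = Num.sqrt (\tr (X^T *m X)).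
Proof.
rewrite /frobenius_norm exchange_big /=; congr Num.sqrt.
by apply: eq_bigr => j _; rewrite mxE; apply: eq_bigr => i _; rewrite !mxE.
Qed.

(** Applying a polynomial to the Gram matrix acts on all singular values at
    once: [X q(X^T X)] has Gram matrix [r(X^T X)] with [r = q 'X q].  Taking
    [q = p] yields the singular values of [Y], and [q = 1 - p] yields the
    distance from [X], as the trace of a Gram matrix. *)
Lemma hard_threshold (R : rcfType) m n (X : 'M[R]_(m, n)) (nu : R) :
  exists Y : 'M[R]_(m, n),
    perm_eq (singular_values Y)
      [seq (if nu <= t then t else 0) | t <- singular_values X] /\
    frobenius_norm (X - Y) =
      Num.sqrt (\sum_(t <- singular_values X | t < nu) t ^+ 2).
Proof.
have sv_ge0 (Z : 'M[R]_(m, n)) t : t \in (singular_values Z : seq R) -> 0 <= t.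
  by move=> /tnthP[i ->]; exact: singular_values_ge0.
(* Polynomials of square matrices need a positive size. *)
case: n X sv_ge0 => [|n] X sv_ge0.
  exists X; split; first by rewrite !tuple0.
  rewrite subrr /frobenius_norm tuple0 big_nil big1// => i _.
  by rewrite big_ord0.
set s := singular_values X.
have char_gram (Z : 'M[R]_(m, n.+1)) : char_poly (Z^T *m Z) =
    \prod_(a <- [seq t ^+ 2 | t <- singular_values Z]) ('X - a%:P).
  by rewrite char_poly_gram_singular_values big_map big_tuple.
have G_sym : (X^T *m X)^T = X^T *m X by rewrite trmx_mul trmxK.
have [p ps] := exists_interpolation [seq t ^+ 2 | t <- s]
  (fun a => if nu <= Num.sqrt a then 1 else 0).
have psE t : t \in (s : seq R) -> p.[t ^+ 2] = if nu <= t then 1 else 0.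
  move=> ts; rewrite ps; last exact: (map_f (fun t => t ^+ 2) ts).
  by rewrite sqrtr_sqr ger0_norm ?(sv_ge0 X).
pose hG := horner_mx (X^T *m X).
have gram_horner q : (X *m hG q)^T *m (X *m hG q) = hG (q * 'X * q).
  rewrite /hG trmx_mul trmx_horner_mx G_sym !rmorphM /= horner_mx_X.
  by rewrite -[RHS]/(_ *m _ *m _) -!mulmxA.
exists (X *m hG p); split.
  have /prod_XsubC_eq :
      \prod_(a <- [seq t ^+ 2 | t <- singular_values (X *m hG p)]) ('X - a%:P) =
      \prod_(a <- [seq (if nu <= t then t else 0) ^+ 2 | t <- s]) ('X - a%:P).
    rewrite -char_gram gram_horner.
    rewrite (char_poly_horner_symmetric _ G_sym (char_gram X)).
    rewrite !big_map !big_seq; apply: eq_bigr => t ts.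
    rewrite !(hornerM, hornerX) psE//.
    by case: ifP; rewrite ?mul1r ?mulr1 ?mul0r// expr0n.
  have sqrtK (r : seq R) : {in r, forall t, 0 <= t} ->
      [seq Num.sqrt a | a <- [seq t ^+ 2 | t <- r]] = r.
    move=> r0; rewrite -map_comp -[RHS]map_id; apply/eq_in_map => t /r0 t0 /=.
    by rewrite sqrtr_sqr ger0_norm.
  rewrite [X in perm_eq _ X](map_comp (fun t => t ^+ 2)
    (fun t => if nu <= t then t else 0)).
  move=> /(perm_map Num.sqrt); rewrite (sqrtK _ (sv_ge0 _)) sqrtK//.
  by move=> _ /mapP[t ts ->]; case: ifP => // _; exact: (sv_ge0 X).
have -> : X - X *m hG p = X *m hG (1 - p).
  by rewrite /hG rmorphB /= rmorph1 mulmxBr mulmx1.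
rewrite frobenius_norm_trace gram_horner; congr Num.sqrt.
set q := (1 - p) * 'X * (1 - p).
have := char_poly_horner_symmetric q G_sym (char_gram X); rewrite big_map.
rewrite -(big_map (fun t => q.[t ^+ 2]) xpredT (fun a => 'X - a%:P)) /q.
move=> /mxtrace_char_poly ->; rewrite big_map [RHS]big_mkcond /= !big_seq.
apply: eq_bigr => t ts.
rewrite !(hornerM, hornerX, hornerD, hornerN, hornerC) psE// ltNge.
by case: (nu <= t); rewrite ?subrr ?mul0r// subr0 mul1r mulr1.
Qed.

Lemma sqrt_sum_sqr_le_sum (R : rcfType) (s : seq R) (P : pred R) :
  {in s, forall t, 0 <= t} ->
  Num.sqrt (\sum_(t <- s | P t) t ^+ 2) <= \sum_(t <- s | P t) t.
Proof.
move=> s0.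
have S0 : 0 <= \sum_(t <- s | P t) t.
  by rewrite big_seq_cond; apply: sumr_ge0 => t /andP[/s0].
rewrite -[leRHS]ger0_norm// -sqrtr_sqr ler_wsqrtr// {S0}.
(* The sign of the partial sums is carried along for the cross terms. *)
suff [] : 0 <= \sum_(t <- s | P t) t /\
    \sum_(t <- s | P t) t ^+ 2 <= (\sum_(t <- s | P t) t) ^+ 2 by [].
elim: s s0 => [|a s IH] s0; first by rewrite !big_nil expr0n.
have [|S0 le_S] := IH; first by move=> t ts; rewrite s0// inE ts orbT.
rewrite !big_cons; case: (P a) => //.
have a0 : 0 <= a by rewrite s0// mem_head.
split; first exact: addr_ge0.
rewrite sqrrD -addrA lerD2l (le_trans le_S)// lerDr.
by rewrite mulrn_wge0// mulr_ge0.
Qed.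

(** * Rank and capped penalty *)

Lemma norm0_sum (R : rcfType) n (s : n.-tuple R) :
  (norm0 s)%:R = \sum_(t <- s) (t != 0)%:R :> R.
Proof.
rewrite big_tuple -natr_sum /norm0 -sum1_card; congr (_%:R).
by rewrite -big_mkcond /=; apply: eq_bigl => i; rewrite inE.
Qed.

(** The first term contributes the rank of the thresholded matrix, the second
    one the penalty gained by removing [t]. *)
Lemma capped_decomp (R : rcfType) (nu t : R) : 0 < nu ->
  capped nu t = (nu <= t)%R%:R + (if t < nu then t else 0) / nu.
Proof.
move=> nu0; rewrite /capped.
have [nut|tnu] := leP nu t.
  by rewrite mul0r addr0 min_l// ler_pdivlMr// mul1r.
by rewrite add0r min_r// ler_pdivrMr// mul1r ltW.
Qed.

Lemma Phi_le_norm0 (R : rcfType) m n (nu : R) (X : 'M[R]_(m, n)) :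
  0 < nu -> Phi nu X <= (norm0 (singular_values X))%:R.
Proof.
move=> nu0; rewrite norm0_sum big_tuple; apply: ler_sum => i _.
rewrite /capped; case: eqP => [->|_]; last by rewrite ge_min lexx.
by rewrite mul0r ge_min lexx orbT.
Qed.

(** * Comparison of the two objectives *)

(** Thresholding trades the penalty [lambda * S / nu] of the removed singular
    values for an increase of [f] by at most [Lf * S], where [S] is their sum.
    The trade is strictly favorable unless [S = 0], that is unless no singular
    value lies in the interval where capped and l0 penalties differ; this is
    the last claim. *)
Lemma threshold_decreases (R : rcfType) m n (f : 'M[R]_(m, n) -> R)
    (lambda Lf nu : R) (X : 'M[R]_(m, n)) :
  0 <= Lf -> 0 < nu -> nu * Lf < lambda ->
  (forall X Y, `|f X - f Y| <= Lf * frobenius_norm (X - Y)) ->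
  exists2 Y, F_l0 f lambda Y <= F_relaxed f lambda nu X &
    F_relaxed f lambda nu X <= F_l0 f lambda Y ->
    F_l0 f lambda X = F_relaxed f lambda nu X.
Proof.
move=> Lf0 nu0 nu_lt f_lip; have [Y [svY distY]] := hard_threshold X nu.
set s := singular_values X in svY distY.
have s0 : {in (s : seq R), forall t, 0 <= t}.
  by move=> _ /tnthP[i ->]; exact: singular_values_ge0.
pose S := \sum_(t <- s | t < nu) t.
have rankY : (norm0 (singular_values Y))%:R = \sum_(t <- s) (nu <= t)%R%:R :> R.
  rewrite norm0_sum (perm_big _ svY) big_map; apply: eq_bigr => t _.
  by case: ifP => nut; rewrite ?eqxx// gt_eqF// (lt_le_trans nu0).
have PhiX : Phi nu X = (norm0 (singular_values Y))%:R + S / nu.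
  rewrite rankY /S [X in _ + X / _]big_mkcond mulr_suml -big_split /= /Phi -/s.
  rewrite -(big_tuple _ _ s xpredT (capped nu)).
  by apply: eq_bigr => t _; rewrite capped_decomp.
have S0 : 0 <= S by rewrite /S big_seq_cond; apply: sumr_ge0 => t /andP[/s0].
have fY : f Y <= f X + Lf * S.
  rewrite -lerBlDl (le_trans (ler_norm _))// distrC (le_trans (f_lip _ _))//.
  by rewrite distY ler_wpM2l// sqrt_sum_sqr_le_sum.
have gap : F_l0 f lambda Y <= F_relaxed f lambda nu X - (lambda / nu - Lf) * S.
  rewrite /F_l0 /F_relaxed PhiX.
  have -> : f X + lambda * ((norm0 (singular_values Y))%:R + S / nu)
      - (lambda / nu - Lf) * S
    = (f X + Lf * S) + lambda * (norm0 (singular_values Y))%:R.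
    by ring.
  by rewrite lerD2r.
have slope0 : 0 < lambda / nu - Lf.
  by rewrite subr_gt0 ltr_pdivlMr// mulrC.
exists Y => [|F_le]; first by rewrite (le_trans gap)// gerBl mulr_ge0// ltW.
have S_eq0 : S = 0.
  apply/eqP; rewrite eq_le S0 andbT -(pmulr_rle0 _ slope0).
  by have := le_trans F_le gap; rewrite lerBrDr gerDl.
rewrite /F_l0 /F_relaxed; congr (_ + _ * _).
rewrite norm0_sum big_tuple; apply: eq_bigr => i _; rewrite capped_decomp//.
set t := tnth _ i; have [nut|tnu] := leP nu t.
  by rewrite mul0r addr0 gt_eqF// (lt_le_trans nu0).
suff -> : t = 0 by rewrite eqxx mul0r addr0.
move: S_eq0; rewrite /S big_tuple => /psumr_eq0P; apply=> // j _.
exact: singular_values_ge0.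
Qed.

Theorem theorem2p5 (R : realType) (m n : nat) (f : 'M[R]_(m, n) -> R)
    (lambda Lf nu : R)
    (n_gt0 : (0 < n)%N) (le_nm : (n <= m)%N)
    (lambda_gt0 : 0 < lambda)
    (f_ge0 : forall X, 0 <= f X)
    (f_convex : convex_function (E := 'M[R]_(m, n)) setT f)
    (Lf_gt0 : 0 < Lf)
    (f_lipschitz : forall X Y, `|f X - f Y| <= Lf * frobenius_norm (X - Y))
    (nu_gt0 : 0 < nu) (nu_lt : nu < lambda / Lf) :
  (forall X : 'M[R]_(m, n),
     global_minimizer (F_l0 f lambda) X <->
     global_minimizer (F_relaxed f lambda nu) X) /\
  optimal_value (F_l0 f lambda) = optimal_value (F_relaxed f lambda nu).
Proof.
have relaxed_le X : F_relaxed f lambda nu X <= F_l0 f lambda X.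
  by rewrite lerD2l ler_wpM2l ?Phi_le_norm0// ltW.
have nuLf : nu * Lf < lambda by rewrite -ltr_pdivlMr.
have threshold X := threshold_decreases X (ltW Lf_gt0) nu_gt0 nuLf f_lipschitz.
split=> [X|].
  split=> X_min Z.
    have [Y leY _] := threshold Z.
    exact: le_trans (relaxed_le X) (le_trans (X_min Y) leY).
  have [Y _ ->] := threshold X.
    exact: le_trans (X_min Z) (relaxed_le Z).
  exact: le_trans (X_min Y) (relaxed_le Y).
apply/le_anti/andP; split; apply: le_ereal_inf_tmp => _ [Z _ <-];
  apply: ge_ereal_inf.
  have [Y leY _] := threshold Z.
  by exists (F_l0 f lambda Y)%:E; [exists Y | rewrite lee_fin].
by exists (F_relaxed f lambda nu Z)%:E; [exists Z | rewrite lee_fin].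
Qed.
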